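(* Consider the single stage pricing game with additive loyalty described in the context, with parameters $c_A\ge c_B\ge 0$, $s_\alpha,s_\beta\ge0$, $\theta\in(0,1)$, and $F$ the distribution function of the uniform distribution on $[0,1]$. Suppose (Region III) $$\max(1-s_\beta,\;s_\alpha+2)\le c_A-c_B .$$ Then the game has a unique pure Nash equilibrium, and its prices are $$p_A^\alpha=c_A,\quad p_A^\beta=c_A,\quad p_B^\beta=c_A+s_\beta,\quad p_B^\alpha=c_A-s_\alpha-1 .$$
   Context: Two firms $A$ and $B$ sell the same product, with unit product costs $c_A$ and $c_B$, where $c_A\ge c_B\ge 0$. Customers are partitioned into a set $\alpha$ (ex ante loyal to $A$; a fraction $\theta$ of the market) and a set $\beta$ (ex ante loyal to $B$; a fraction $1-\theta$). Both firms can tell the two sets apart. Each customer buys exactly one unit, from $A$ or from $B$. Firms move simultaneously: $A$ chooses $(p_A^\alpha,p_A^\beta)$ with $p_A^\alpha,p_A^\beta\ge c_A$, and $B$ chooses $(p_B^\beta,p_B^\alpha)$ with $p_B^\beta,p_B^\alpha\ge c_B$; the superscript is the set of customers to which the price is offered. Additive loyalty: a customer in $\alpha$ has loyalty level $\xi+s_\alpha$ and buys from $A$ iff $\xi+s_\alpha\ge p_A^\alpha-p_B^\alpha$; a customer in $\beta$ has loyalty level $\xi+s_\beta$ and buys from $B$ iff $\xi+s_\beta\ge p_B^\beta-p_A^\beta$; here $\xi$ is random with distribution function $F$. Put $\xi^\alpha=p_A^\alpha-p_B^\alpha-s_\alpha$ and $\xi^\beta=p_B^\beta-p_A^\beta-s_\beta$.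 For the uniform distribution, $F(x)=0$ for $x\le 0$, $F(x)=x$ for $0\le x\le1$, $F(x)=1$ for $x\ge1$. Profits: firm $A$ gets $(p_A^\alpha-c_A)\,\theta\,(1-F(\xi^\alpha))+(p_A^\beta-c_A)(1-\theta)F(\xi^\beta)$; firm $B$ gets $(p_B^\beta-c_B)(1-\theta)(1-F(\xi^\beta))+(p_B^\alpha-c_B)\,\theta\,F(\xi^\alpha)$. A pure Nash equilibrium is a price profile $(p_A^\alpha,p_A^\beta,p_B^\beta,p_B^\alpha)$ from which neither firm can strictly increase its profit by unilaterally changing its own (feasible) prices. *)

(* Defs.v *)
From mathcomp Require Import all_boot all_order all_algebra.
From mathcomp Require Import reals.
Set Implicit Arguments.
Unset Strict Implicit.
Unset Printing Implicit Defensive.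
Import Order.TTheory GRing.Theory Num.Theory.
Local Open Scope ring_scope.

Definition uniform01_cdf (R : realType) (x : R) : R :=
  if x <= 0 then 0 else if x <= 1 then x else 1.

(* [market_share] is the fraction theta of customers ex ante loyal to A, the
   set alpha; [s_alpha] and [s_beta] are the additive loyalty constants. *)
Record market (R : realType) := Market {
  cost_A : R;
  cost_B : R;
  s_alpha : R;
  s_beta : R;
  market_share : R
}.

(* A pure strategy of either firm: the prices that the firm offers to the
   customers in alpha and to the customers in beta. *)
Record prices (R : realType) := Prices {
  price_alpha : R;
  price_beta : R
}.

Definition feasible (R : realType) (c : R) (p : prices R) : Prop :=
  c <= price_alpha p /\ c <= price_beta p.

(* A customer in alpha, with loyalty level xi + s_alpha, buys from A iff
   xi >= threshold_alpha; a customer in beta, with loyalty level xi + s_beta,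
   buys from B iff xi >= threshold_beta. *)
Definition threshold_alpha (R : realType) (m : market R) (a b : prices R) : R :=
  price_alpha a - price_alpha b - s_alpha m.

Definition threshold_beta (R : realType) (m : market R) (a b : prices R) : R :=
  price_beta b - price_beta a - s_beta m.

Definition profit_A (R : realType) (F : R -> R) (m : market R)
    (a b : prices R) : R :=
  (price_alpha a - cost_A m) * market_share m * (1 - F (threshold_alpha m a b))
  + (price_beta a - cost_A m) * (1 - market_share m) * F (threshold_beta m a b).

Definition profit_B (R : realType) (F : R -> R) (m : market R)
    (a b : prices R) : R :=
  (price_beta b - cost_B m) * (1 - market_share m)
    * (1 - F (threshold_beta m a b))
  + (price_alpha b - cost_B m) * market_share m * F (threshold_alpha m a b).

(* A profile pairs the strategy of A with the strategy of B. *)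
Definition pure_nash_equilibrium (R : realType) (F : R -> R) (m : market R)
    (p : prices R * prices R) : Prop :=
  [/\ feasible (cost_A m) p.1,
      feasible (cost_B m) p.2,
      forall a : prices R, feasible (cost_A m) a ->
        profit_A F m a p.2 <= profit_A F m p.1 p.2
    & forall b : prices R, feasible (cost_B m) b ->
        profit_B F m p.1 b <= profit_B F m p.1 p.2].

(* Main.v *)
(** The two customer sets are separate price games of the same shape.  With
    markups [u] for A and [v] for B over their own costs, and since
    [1 - F x = F (1 - x)], the profits per customer in each set are
    [u F(v - k - u)] for A and [v F(1 + k + u - v)] for B, where
    [k = c_A - c_B - s_alpha - 1] in alpha and [k = c_A - c_B + s_beta] in beta;
    Region III says that [k >= 1] in both.  Then B's only best reply is to
    serve the whole set at the highest possible markup [v = k + u], which leaves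
    A with zero profit; if [u > 0], A would gain by halving its markup. *)
Require Import Defs.
From mathcomp Require Import all_boot all_order all_algebra.
From mathcomp Require Import reals.
From mathcomp Require Import ring lra.
Set Implicit Arguments.
Unset Strict Implicit.
Unset Printing Implicit Defensive.
Import Order.TTheory GRing.Theory Num.Theory.
Local Open Scope ring_scope.

Section Uniform.
Variable R : realType.
Implicit Types x k u v : R.
Local Notation F := (@uniform01_cdf R).

Variant uniform01_cdf_spec x : R -> Prop :=
  | Uniform01Low of x <= 0 : uniform01_cdf_spec x 0
  | Uniform01Mid of 0 < x & x <= 1 : uniform01_cdf_spec x x
  | Uniform01High of 1 < x : uniform01_cdf_spec x 1.

Lemma uniform01_cdfP x : uniform01_cdf_spec x (F x).
Proof.
rewrite /uniform01_cdf; case: (lerP x 0) => [?|x_gt0]; first by constructor.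
by case: (lerP x 1) => ?; constructor.
Qed.

Lemma uniform01_cdf_le0 x : x <= 0 -> F x = 0.
Proof. by case: uniform01_cdfP => // *; lra. Qed.

Lemma uniform01_cdf_ge1 x : 1 <= x -> F x = 1.
Proof. by case: uniform01_cdfP => // *; lra. Qed.

Lemma uniform01_cdf_gt0 x : 0 < x -> 0 < F x.
Proof. by case: uniform01_cdfP => // *; lra. Qed.

(** The uniform law is symmetric about 1/2. This puts the share [1 - F] of the firm favoured by
    loyalty into the same form as its rival's share. *)
Lemma uniform01_cdf_onem x : F (1 - x) = 1 - F x.
Proof. by case: uniform01_cdfP; case: uniform01_cdfP => *; lra. Qed.

(** With [K = k + u], on the sloping part of [F] one has [v (1 + K - v) - K = (v - K) (1 - v)], and
    there [v >= K >= 1]. *)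
Lemma best_reply_le k u v : 1 <= k -> 0 <= u -> 0 <= v ->
  v * F (1 + k + u - v) <= k + u.
Proof. by move=> *; case: uniform01_cdfP => *; nra. Qed.

Lemma best_reply_eq k u v : 1 <= k -> 0 <= u -> 0 <= v ->
  k + u <= v * F (1 + k + u - v) -> v = k + u.
Proof.
move=> k_ge1 u_ge0 v_ge0; case: uniform01_cdfP => *; [lra | | lra].
(* If [v > K = k + u], then [v > 1] and [(v - K) (1 - v)] would be negative. *)
by apply/le_anti/andP; split; nra.
Qed.

(** Equilibrium within one customer set. In markups, feasibility is nonnegativity; the size of the
    set is only a positive factor and is dropped. *)
Definition segment_nash k u v : Prop :=
  [/\ 0 <= u, 0 <= v,
      forall u', 0 <= u' -> u' * F (v - k - u') <= u * F (v - k - u)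
    & forall v', 0 <= v' -> v' * F (1 + k + u - v') <= v * F (1 + k + u - v)].

Lemma segment_nashP k u v : 1 <= k -> segment_nash k u v <-> u = 0 /\ v = k.
Proof.
move=> k_ge1; split=> [[u_ge0 v_ge0 bestA bestB] | [-> ->]].
- have v_eq : v = k + u.
    (* At markup [k + u] the argument of [F] is 1, so B sells to the whole set and earns [k + u]. *)
    apply: best_reply_eq => //; apply: le_trans (bestB (k + u) _); last by lra.
    by rewrite [F _]uniform01_cdf_ge1 ?mulr1 //; lra.
  suff u_eq0 : u = 0 by split; lra.
  apply/eqP; case: (ltrgtP u 0) => // [?|u_gt0]; first by lra.
  (* Since [v = k + u], the markup [u] gives [F 0 = 0], while [u / 2] gives [F (u / 2) > 0]. *)
  have /bestA : 0 <= u / 2 by lra.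
  rewrite [F (v - k - u)]uniform01_cdf_le0 ?mulr0; last by lra.
  by rewrite leNgt mulr_gt0 ?uniform01_cdf_gt0 //; lra.
- split=> [||u' u'_ge0|v' v'_ge0]; [lra | lra | |].
  + by rewrite mul0r uniform01_cdf_le0 ?mulr0 //; lra.
  + apply: le_trans (best_reply_le k_ge1 (lexx 0) v'_ge0) _.
    by rewrite [F _]uniform01_cdf_ge1 ?mulr1 //; lra.
Qed.

Section Market.
Variable m : market R.
Implicit Types a b p : prices R.

(** A sells in a set only if B's markup exceeds A's by more than the handicap. *)
Definition handicap_alpha : R := cost_A m - cost_B m - s_alpha m - 1.
Definition handicap_beta : R := cost_A m - cost_B m + s_beta m.

Lemma profit_A_segments a b :
  let u := price_alpha a - cost_A m in let v := price_alpha b - cost_B m in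
  let u' := price_beta a - cost_A m in let v' := price_beta b - cost_B m in
  profit_A F m a b = market_share m * (u * F (v - handicap_alpha - u))
    + (1 - market_share m) * (u' * F (v' - handicap_beta - u')).
Proof.
move=> u v u' v'; rewrite /profit_A -uniform01_cdf_onem.
rewrite (_ : v - _ - u = 1 - threshold_alpha m a b); last first.
  by rewrite /u /v /handicap_alpha /threshold_alpha; ring.
rewrite (_ : v' - _ - u' = threshold_beta m a b); last first.
  by rewrite /u' /v' /handicap_beta /threshold_beta; ring.
by rewrite /u /u'; ring.
Qed.

Lemma profit_B_segments a b :
  let u := price_alpha a - cost_A m in let v := price_alpha b - cost_B m in
  let u' := price_beta a - cost_A m in let v' := price_beta b - cost_B m in
  profit_B F m a b = market_share m * (v * F (1 + handicap_alpha + u - v))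
    + (1 - market_share m) * (v' * F (1 + handicap_beta + u' - v')).
Proof.
move=> u v u' v'; rewrite /profit_B -uniform01_cdf_onem.
rewrite (_ : 1 + _ + u - v = threshold_alpha m a b); last first.
  by rewrite /u /v /handicap_alpha /threshold_alpha; ring.
rewrite (_ : 1 + _ + u' - v' = 1 - threshold_beta m a b); last first.
  by rewrite /u' /v' /handicap_beta /threshold_beta; ring.
by rewrite /v /v'; ring.
Qed.

(** Each profit is a sum over the two sets with positive weights, and a firm's two prices enter
    different terms, so they are optimised separately. *)
Lemma pure_nash_segments a b :
  0 < market_share m -> market_share m < 1 ->
  pure_nash_equilibrium F m (a, b) <->
  segment_nash handicap_alpha
    (price_alpha a - cost_A m) (price_alpha b - cost_B m) /\
  segment_nash handicap_beta
    (price_beta a - cost_A m) (price_beta b - cost_B m).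
Proof.
move=> share_gt0 share_lt1.
have share'_gt0 : 0 < 1 - market_share m by rewrite subr_gt0.
split=> [[/= [feasAa feasAb] [feasBa feasBb] bestA bestB] |].
- split; split=> [||x x_ge0|x x_ge0]; rewrite ?subr_ge0 //.
  (* Deviating in one set only leaves the other term unchanged, so it cancels. *)
  + have /bestA : feasible (cost_A m) (Prices (cost_A m + x) (price_beta a)).
      by split; rewrite //= lerDl.
    by rewrite !profit_A_segments /= lerD2r ler_pM2l // [_ + x]addrC addrK.
  + have /bestB : feasible (cost_B m) (Prices (cost_B m + x) (price_beta b)).
      by split; rewrite //= lerDl.
    by rewrite !profit_B_segments /= lerD2r ler_pM2l // [cost_B m + x]addrC addrK.
  + have /bestA : feasible (cost_A m) (Prices (price_alpha a) (cost_A m + x)).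
      by split; rewrite //= lerDl.
    by rewrite !profit_A_segments /= lerD2l ler_pM2l // [_ + x]addrC addrK.
  + have /bestB : feasible (cost_B m) (Prices (price_alpha b) (cost_B m + x)).
      by split; rewrite //= lerDl.
    by rewrite !profit_B_segments /= lerD2l ler_pM2l // [cost_B m + x]addrC addrK.
- case=> -[ua_ge0 va_ge0 bestAa bestBa] [ub_ge0 vb_ge0 bestAb bestBb].
  split=> /= [||p [pa pb]|p [pa pb]]; try by split; rewrite -subr_ge0.
  + rewrite !profit_A_segments /= lerD // ler_pM2l //.
      by apply: bestAa; rewrite subr_ge0.
    by apply: bestAb; rewrite subr_ge0.
  + rewrite !profit_B_segments /= lerD // ler_pM2l //.
      by apply: bestBa; rewrite subr_ge0.
    by apply: bestBb; rewrite subr_ge0.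
Qed.

End Market.
End Uniform.

Theorem proposition17 (R : realType) (m : market R)
    (cost_B_ge0 : 0 <= cost_B m)
    (cost_B_le_A : cost_B m <= cost_A m)
    (s_alpha_ge0 : 0 <= s_alpha m)
    (s_beta_ge0 : 0 <= s_beta m)
    (share_gt0 : 0 < market_share m)
    (share_lt1 : market_share m < 1)
    (region_III :
      Num.max (1 - s_beta m) (s_alpha m + 2) <= cost_A m - cost_B m) :
  unique (pure_nash_equilibrium (@uniform01_cdf R) m)
    ({| price_alpha := cost_A m; price_beta := cost_A m |},
     {| price_alpha := cost_A m - s_alpha m - 1;
        price_beta := cost_A m + s_beta m |}).
Proof.
move: region_III; rewrite ge_max => /andP[beta_region alpha_region].
have ka_ge1 : 1 <= handicap_alpha m by rewrite /handicap_alpha; lra.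
have kb_ge1 : 1 <= handicap_beta m by rewrite /handicap_beta; lra.
split=> [|[[aa ab] [ba bb]]].
- apply/pure_nash_segments => //=.
  (* B's markups are the handicaps, at least 1, so its prices are feasible. *)
  by split; apply/segment_nashP => //;
    rewrite /handicap_alpha /handicap_beta; split; ring.
- move=> /(pure_nash_segments _ _ share_gt0 share_lt1) /=.
  rewrite !segment_nashP // /handicap_alpha /handicap_beta.
  case=> -[aa_eq ba_eq] [ab_eq bb_eq].
  by congr (Prices _ _, Prices _ _); lra.
Qed.
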